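(* Let $(\mathbb J,\mathbb J')$ be an invariant generalized almost Kähler structure on the maximal flag manifold $\mathbb F$. Then, for every $\alpha\in\Pi^+$, the pair $(\mathbb J_\alpha,\mathbb J'_\alpha)$ takes one of the following values: $$(\mathcal J_0,(\mathcal J'_\alpha)^+),\qquad(\mathcal J_\alpha^+,\mathcal J_0),\qquad(-\mathcal J_0,(\mathcal J'_\alpha)^-),\qquad(\mathcal J_\alpha^-,-\mathcal J_0),$$ where the superscript $+$ (resp. $-$) denotes a structure of noncomplex type with $x_\alpha>0$ (resp. $x_\alpha<0$).
   Context: Setting. $\mathfrak g$ is the Lie algebra of a complex semisimple Lie group $G$, $\mathfrak h\subset\mathfrak g$ a Cartan subalgebra, $\Pi$ the set of roots, $\Pi^+$ a choice of positive roots with simple system $\Sigma$, $\langle\cdot,\cdot\rangle$ the Cartan–Killing form, $H_\alpha\in\mathfrak h$ defined by $\alpha=\langle H_\alpha,\cdot\rangle$, $\mathfrak h_{\mathbb R}$ the real span of the $H_\alpha$, and $X_\alpha\in\mathfrak g_\alpha$ a Weyl basis ($\langle X_\alpha,X_{-\alpha}\rangle=1$, $[X_\alpha,X_\beta]=m_{\alpha,\beta}X_{\alpha+\beta}$ with $m_{\alpha,\beta}\in\mathbb R$, $m_{-\alpha,-\beta}=-m_{\alpha,\beta}$, and $m_{\alpha,\beta}=0$ if $\alpha+\beta$ is not a root). Put $A_\alpha=X_\alpha-X_{-\alpha}$, $S_\alpha=i(X_\alpha+X_{-\alpha})$, $\mathfrak u_\alpha=\mathrm{span}_{\mathbb R}\{A_\alpha,S_\alpha\}$.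 The compact real form is $\mathfrak u=i\mathfrak h_{\mathbb R}\oplus\bigoplus_{\alpha\in\Pi^+}\mathfrak u_\alpha$, with group $U=\exp\mathfrak u$ and maximal torus $T$, $\mathrm{Lie}(T)=\mathfrak t=i\mathfrak h_{\mathbb R}$. The maximal flag manifold is $\mathbb F=U/T$ with origin $b_0$, and $T_{b_0}\mathbb F=\mathfrak n^-:=\bigoplus_{\alpha\in\Pi^+}\mathfrak u_\alpha$. Fix a regular $H\in\mathfrak t$; $\omega_{b_0}(X,Y)=\langle H,[X,Y]\rangle$, $k_\alpha=\frac1{2i\langle H,H_\alpha\rangle}$, and for $X\in\mathfrak u_\alpha$ put $X^\ast=k_\alpha\omega_{b_0}(X,\cdot)\in\mathfrak u_\alpha^\ast$; $(-S_\alpha^\ast,A_\alpha^\ast)$ is the basis dual to $(A_\alpha,S_\alpha)$. Generalized structures. $V\oplus V^\ast$ carries $\langle X+\xi,Y+\eta\rangle=\frac12(\xi(Y)+\eta(X))$. An invariant generalized almost complex structure on $\mathbb F$ is identified with its value at $b_0$, a map $\mathbb J$ on $\mathfrak n^-\oplus(\mathfrak n^-)^\ast$ that is an isometry, satisfies $\mathbb J^2=-1$ and commutes with the adjoint action of $T$. It splits as $\mathbb J=\bigoplus_{\alpha\in\Pi^+}\mathbb J_\alpha$, with $\mathbb J_\alpha$ on $\mathfrak u_\alpha\oplus\mathfrak u_\alpha^\ast$; in the basis $(A_\alpha,S_\alpha,-S_\alpha^\ast,A_\alpha^\ast)$, $\mathbb J_\alpha$ is either of complex type, $\pm\mathcal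 J_0$, or of noncomplex type, $\mathcal J_\alpha$, where $$\mathcal J_0=\begin{pmatrix}0&-1&0&0\\ 1&0&0&0\\ 0&0&0&-1\\ 0&0&1&0\end{pmatrix},\qquad \mathcal J_\alpha=\begin{pmatrix}a_\alpha&0&0&-x_\alpha\\ 0&a_\alpha&x_\alpha&0\\ 0&-y_\alpha&-a_\alpha&0\\ y_\alpha&0&0&-a_\alpha\end{pmatrix},\quad a_\alpha,x_\alpha,y_\alpha\in\mathbb R,\ a_\alpha^2=x_\alpha y_\alpha-1.$$ An invariant generalized almost Kähler structure is a pair $(\mathbb J,\mathbb J')$ of commuting invariant generalized almost complex structures such that $G=-\mathbb J\mathbb J'$ is positive definite, i.e. $\langle Gv,v\rangle>0$ for $v\neq0$. *)

(* Defs.v *)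
From HB Require Import structures.
From mathcomp Require Import all_boot all_order all_algebra.
From mathcomp Require Import complex.
From mathcomp Require Import classical_sets reals topology normedtype sequences.

Set Implicit Arguments.
Unset Strict Implicit.
Unset Printing Implicit Defensive.

Import Order.TTheory GRing.Theory Num.Theory.
Import numFieldNormedType.Exports.

Local Open Scope ring_scope.

(* Restriction of scalars: a complex vector space seen as a real one. *)
Definition realified (R : rcfType) (g : vectType R[i]) : Type := g.

Section Realified.
Import VectorInternalTheory.
Variables (R : rcfType) (g : vectType R[i]).

HB.instance Definition _ := GRing.Zmodule.copy (realified g) g.

Definition rscale (a : R) (v : realified g) : realified g :=
  (real_complex R a) *: (v : g).

Fact rscaleA a b v : rscale a (rscale b v) = rscale (a * b) v.
Proof. by rewrite /rscale scalerA rmorphM. Qed.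
Fact rscale1 : left_id 1 rscale.
Proof. by move=> v; rewrite /rscale rmorph1 scale1r. Qed.
Fact rscaleDr : right_distributive rscale +%R.
Proof. by move=> a u v; rewrite /rscale scalerDr. Qed.
Fact rscaleDl v : {morph rscale^~ v : a b / a + b}.
Proof. by move=> a b; rewrite /rscale rmorphD scalerDl. Qed.

HB.instance Definition _ := GRing.Zmodule_isLmodule.Build R (realified g)
  rscaleA rscale1 rscaleDr rscaleDl.

Fact realified_vect_iso : Vector.axiom (dim g + dim g) (realified g).
Proof.
pose f (v : realified g) : 'rV[R]_(dim g + dim g) :=
  row_mx (\row_j complex.Re (v2r (v : g) 0 j))
         (\row_j complex.Im (v2r (v : g) 0 j)).
exists f.
  move=> a u v; have E i : v2r (a *: u + v : g) 0 i =
      real_complex R a * v2r (u : g) 0 i + v2r (v : g) 0 i.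
    by rewrite [a *: u]/(rscale a u) /rscale linearP !mxE.
  apply/rowP=> j; rewrite !mxE; case: split => k; rewrite !mxE E;
    by case: (v2r (u : g) 0 k) => x y; case: (v2r (v : g) 0 k) => z t /=;
       rewrite ?mul0r ?subr0 ?addr0.
exists (fun w : 'rV[R]_(dim g + dim g) => (r2v (\row_j
   (Complex (w 0 (lshift _ j)) (w 0 (rshift _ j)) : R[i])) : g)).
  move=> v; apply: (can_inj (@v2rK _ g)); rewrite r2vK.
  apply/rowP=> j; rewrite !mxE (unsplitK (inl _ j)) (unsplitK (inr _ j)).
  by rewrite !mxE; case: (v2r _ 0 j).
move=> w; apply/rowP=> j; rewrite /f r2vK !mxE -[in RHS](splitK j).
by case: split => k; rewrite !mxE.
Qed.

HB.instance Definition _ :=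
  Lmodule_hasFinDim.Build R (realified g) realified_vect_iso.

End Realified.

(* The bracket of a Lie algebra is given as its adjoint representation
   [br : 'Hom(g, 'End(g))], so that [br x y] is the bracket of x and y and
   bilinearity is built in. *)
Section LieAlgebra.
Variables (K : fieldType) (g : vectType K) (br : 'Hom(g, 'End(g))).

Definition lie_bracket : Prop :=
  (forall x, br x x = 0) /\
  (forall x y z, br x (br y z) + br y (br z x) + br z (br x y) = 0).

Definition lie_ideal (I : {vspace g}) : Prop :=
  forall x y, y \in I -> br x y \in I.

Definition derived (I : {vspace g}) : {vspace g} :=
  <<[seq br x y | x <- vbasis I, y <- vbasis I]>>%VS.

Definition lie_solvable (I : {vspace g}) : Prop :=
  exists n, iter n derived I = 0%VS.

Definition lie_semisimple : Prop :=
  forall I, lie_ideal I -> lie_solvable I -> I = 0%VS.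

Definition lftrace (f : 'End(g)) : K :=
  \sum_(i < \dim (@fullv _ g))
     coord (vbasis fullv) i (f (vbasis (@fullv _ g))`_i).

Definition killing (x y : g) : K := lftrace (br x \o br y)%VF.

Definition lie_abelian (h : {vspace g}) : Prop :=
  forall x y, x \in h -> y \in h -> br x y = 0.

Definition ad_diagonalizable (x : g) : Prop :=
  exists2 b : seq g, basis_of fullv b
    & forall v, v \in b -> exists c : K, br x v = c *: v.

(* Cartan subalgebra of a complex semisimple Lie algebra: a maximal abelian
   subalgebra consisting of ad-semisimple elements. *)
Definition cartan_subalgebra (h : {vspace g}) : Prop :=
  [/\ lie_abelian h,
      forall h' : {vspace g}, (h <= h')%VS -> lie_abelian h' -> h' = h
    & forall x, x \in h -> ad_diagonalizable x].

Variable h : {vspace g}.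

Definition hdual : vectType K := 'Hom(subvs_of h, K^o).

Definition root_vector (a : hdual) (x : g) : Prop :=
  forall H : subvs_of h, br (vsval H) x = a H *: x.

Definition is_root (a : hdual) : Prop :=
  a != 0 /\ exists2 x : g, x != 0 & root_vector a x.

Definition root_set (Pi : seq hdual) : Prop :=
  uniq Pi /\ forall a, a \in Pi <-> is_root a.

Definition nat_comb (Sigma : seq hdual) (a : hdual) : Prop :=
  exists c : hdual -> nat, a = \sum_(s <- Sigma) s *+ c s.

Definition positive_system (Pi Sigma Pip : seq hdual) : Prop :=
  [/\ free Sigma, {subset Sigma <= Pi},
      forall a, a \in Pi -> nat_comb Sigma a \/ nat_comb Sigma (- a),
      uniq Pip
    & forall a, a \in Pip <-> a \in Pi /\ nat_comb Sigma a].

Definition root_duals (Pi : seq hdual) (Hc : hdual -> g) : Prop :=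
  forall a, a \in Pi ->
    Hc a \in h /\ forall H : subvs_of h, a H = killing (Hc a) (vsval H).

End LieAlgebra.

Section WeylBasis.
Variables (R : rcfType) (g : vectType R[i]) (br : 'Hom(g, 'End(g))).
Variable h : {vspace g}.

(* The functions X and m only matter on roots. *)
Definition weyl_basis (Pi : seq (hdual h)) (X : hdual h -> g)
    (m : hdual h -> hdual h -> R) : Prop :=
  [/\ basis_of fullv (vbasis h ++ [seq X a | a <- Pi]),
      forall a, a \in Pi -> root_vector br a (X a),
      forall a, a \in Pi -> killing br (X a) (X (- a)) = 1,
      forall a b, a \in Pi -> b \in Pi -> a + b != 0 ->
        br (X a) (X b) = real_complex R (m a b) *: X (a + b)
    & forall a b, a \in Pi -> b \in Pi ->
        m (- a) (- b) = - m a b /\ (a + b \notin Pi -> m a b = 0)].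

Local Notation iC := (Complex 0 1 : R[i]).

Definition Avec (X : hdual h -> g) (a : hdual h) : g := X a - X (- a).
Definition Svec (X : hdual h -> g) (a : hdual h) : g :=
  iC *: (X a + X (- a)).

Definition ualpha (X : hdual h -> g) (a : hdual h) : {vspace realified g} :=
  <<[:: (Avec X a : realified g); (Svec X a : realified g)]>>%VS.

Definition nminus (X : hdual h -> g) (Pip : seq (hdual h)) :
    {vspace realified g} := (\sum_(a <- Pip) ualpha X a)%VS.

Definition torus (Hc : hdual h -> g) (Pi : seq (hdual h)) :
    {vspace realified g} :=
  <<[seq (iC *: Hc a : realified g) | a <- Pi]>>%VS.

Definition regular (Pi : seq (hdual h)) (H : g) : Prop :=
  forall a, a \in Pi -> a (vsproj h H) != 0.

End WeylBasis.

(* exp D = sum_k D^k / k!, the limit being taken coordinatewise. *)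
Definition expend (R : realType) (V : vectType R) (D : 'End(V)) : 'End(V) :=
  linfun (fun v : V => \sum_(i < \dim (@fullv _ V))
    limn (series (fun k : nat =>
      coord (vbasis fullv) i (iter k D v) / k`!%:R))
    *: (vbasis (@fullv _ V))`_i).

Section GeneralizedTangent.
Variables (R : realType) (V : vectType R).

Definition vdual : vectType R := 'Hom(V, R^o).
Definition gtan : vectType R := (V * vdual)%type.

Definition gpair (v w : gtan) : R := 2^-1 * (v.2 w.1 + w.2 v.1).

Definition gaisometry (J : 'End(gtan)) : Prop :=
  forall v w, gpair (J v) (J w) = gpair v w.

End GeneralizedTangent.

Section Flag.
Variables (R : realType) (g : vectType R[i]) (br : 'Hom(g, 'End(g))).
Variables (h : {vspace g}) (Pi Pip : seq (hdual h)).
Variables (Hc X : hdual h -> g).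

Local Notation V := (subvs_of (nminus X Pip)).

(* Ad(exp H) = exp(ad H) on n^-.  For H in the torus, n^- is stable under
   exp(ad H), so [vsproj] only casts the result back to n^-. *)
Definition AdT (H : g) : 'End(V) :=
  linfun (fun v : V => vsproj (nminus X Pip)
    (expend (linfun (br H : realified g -> realified g)) (vsval v))).

(* The induced action on n^- + (n^-)^*, contragredient on the dual. *)
Definition AdTg (H : g) (v : gtan V) : gtan V :=
  (AdT H v.1, (v.2 \o AdT (- H))%VF).

Definition invariant_gacs (J : 'End(gtan V)) : Prop :=
  [/\ gaisometry J, (J \o J)%VF = - \1%VF
    & forall H : g, (H : realified g) \in torus Hc Pi ->
      forall v, J (AdTg H v) = AdTg H (J v)].

Definition invariant_gak (J J' : 'End(gtan V)) : Prop :=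
  [/\ invariant_gacs J, invariant_gacs J', (J \o J')%VF = (J' \o J)%VF
    & forall v, v != 0 -> 0 < gpair ((- (J \o J')%VF) v) v].

Variable H : g.

Definition kcoef (a : hdual h) : R[i] :=
  (2 * Complex 0 1 * killing br H (Hc a))^-1.

(* X^* = k_a omega(X, .) where omega(X, Y) = <H, [X, Y]>.  For H in the torus
   this is real-valued on n^-, and [Re] only casts from R[i] to R. *)
Definition star (a : hdual h) (x : g) : vdual V :=
  linfun (fun y : V =>
    complex.Re (kcoef a * killing br H (br x (vsval y : g))) : R^o).

Definition gbasis (a : hdual h) : 4.-tuple (gtan V) :=
  [tuple (vsproj (nminus X Pip) (Avec X a : realified g), 0);
         (vsproj (nminus X Pip) (Svec X a : realified g), 0);
         (0, - star a (Svec X a));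
         (0, star a (Avec X a))].

(* J preserves u_a + u_a^* and acts there by the matrix M, in the basis
   (A, S, -S^*, A^* ); column j of M holds the coordinates of the image of the
   j-th basis vector. *)
Definition component_is (J : 'End(gtan V)) (a : hdual h) (M : 'M[R]_4) : Prop :=
  forall j : 'I_4,
    J (tnth (gbasis a) j) = \sum_(i < 4) M i j *: tnth (gbasis a) i.

End Flag.

Definition mx4 (R : nzRingType) (s : seq (seq R)) : 'M[R]_4 :=
  \matrix_(i, j) (nth [::] s i)`_j.

Definition calJ0 (R : nzRingType) : 'M[R]_4 :=
  mx4 [:: [:: 0; -1; 0;  0];
          [:: 1;  0; 0;  0];
          [:: 0;  0; 0; -1];
          [:: 0;  0; 1;  0]].

Definition calJ (R : nzRingType) (a x y : R) : 'M[R]_4 :=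
  mx4 [:: [:: a;  0;  0; -x];
          [:: 0;  a;  x;  0];
          [:: 0; -y; -a;  0];
          [:: y;  0;  0; -a]].

Definition noncomplex_pos (R : realType) (M : 'M[R]_4) : Prop :=
  exists a x y : R, [/\ a ^+ 2 = x * y - 1, 0 < x & M = calJ a x y].

Definition noncomplex_neg (R : realType) (M : 'M[R]_4) : Prop :=
  exists a x y : R, [/\ a ^+ 2 = x * y - 1, x < 0 & M = calJ a x y].

(* Main.v *)
From HB Require Import structures.
Require Import Defs.
From mathcomp Require Import all_boot all_order all_algebra.
From mathcomp Require Import complex.
From mathcomp Require Import boolp functions reals topology normedtype sequences.
From mathcomp Require Import trigo ring lra.

Set Implicit Arguments.
Unset Strict Implicit.
Unset Printing Implicit Defensive.

Import Order.TTheory GRing.Theory Num.Theory.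
Import numFieldNormedType.Exports.
Local Open Scope ring_scope.

(** Write [g_{a,0}, .., g_{a,3}] for the basis [(A_a, S_a, - S_a^*, A_a^* )] of
    the block of the positive root [a].  The pairing matches [g_{a,i}] with
    [g_{a,i+2}] and vanishes on all other pairs, so it reads off coordinates
    ([dualE], [gpair_gbase], [gpair_nondeg]).

    An element [y] of the torus acts on the block of [a] by the rotation of
    angle [angle a y], where [a (y) = i angle a y] ([AdTg_gbase]).  This rests
    on two facts.  First, roots are purely imaginary on the torus, that is
    [b (H_a)] is real: the Jacobi identity expresses [b (H_a)] through the real
    structure constants when [b] is not [a] or [- a], and the remaining case
    follows from the formula of the Killing form as a sum over the roots
    ([ev_coroot_real], [ev_coroot_diag_real], [killing_cartan]).  Second, the
    exponential of a rotation generator is given by the series of cosine and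
    sine ([expend_rotation]).

    Different positive roots are separated by the cosine of their angle at some
    point of the torus, so a structure [J] commuting with the torus preserves
    every block ([gacs_split]).  On one block, [J] commutes with a quarter turn,
    hence is a 2x2 matrix of complex numbers; being orthogonal with square -1 it
    is skew, and a short computation leaves [calJ0], [- calJ0] and the
    noncomplex family ([gacs_block_type]).

    Finally, positivity of [G = - J J'] on the single covector [g_{a,2}] rules
    out two structures of the same type, for which [G g_{a,2}] is orthogonal to
    [g_{a,2}], and in the mixed case equates the sign of [x] with that of the
    complex structure ([gak_block_pair], [gak_diag]). *)

(** * Four by four matrices *)

Lemma ord4P (P : 'I_4 -> Prop) : P 0 -> P 1 -> P 2%:R -> P 3%:R -> forall i, P i.
Proof.
move=> P0 P1 P2 P3 [[|[|[|[|//]]]] lti].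
- by rewrite (_ : Ordinal lti = 0) //; apply: val_inj.
- by rewrite (_ : Ordinal lti = 1) //; apply: val_inj.
- by rewrite (_ : Ordinal lti = 2%:R) //; apply: val_inj.
- by rewrite (_ : Ordinal lti = 3%:R) //; apply: val_inj.
Qed.

Lemma sum_ord4 (V : zmodType) (F : 'I_4 -> V) :
  \sum_i F i = F 0 + F 1 + F 2%:R + F 3%:R.
Proof.
rewrite !big_ord_recl big_ord0 addr0 !addrA.
by congr (_ + F _ + F _ + F _); apply: val_inj.
Qed.

Lemma ord4_add2K (i : 'I_4) : i + 2%:R + 2%:R = i.
Proof. by move: i; apply: ord4P; apply: val_inj. Qed.

(** The pairing matches the basis vector of index [i] with that of index
    [i + 2], so the second hypothesis says that [M] is skew for it.
    Commuting with [calJ0] makes the four 2x2 blocks complex numbers, and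
    skewness then forces the off-diagonal ones to be purely imaginary and the
    diagonal ones to be opposite conjugates. *)
Lemma gacs_matrix_shape (R : realType) (M : 'M[R]_4) :
    M *m calJ0 R = calJ0 R *m M ->
    (forall i j, M (i + 2%:R) j = - M (j + 2%:R) i) ->
  exists p q u w : R, M = mx4 [:: [:: p; q; 0; - u]; [:: - q; p; u; 0];
                                  [:: 0; - w; - p; q]; [:: w; 0; - q; - p]].
Proof.
move=> MJ skew.
have e i j : (M *m calJ0 R) i j = (calJ0 R *m M) i j by rewrite MJ.
have o02 : (0 + 2%:R : 'I_4) = 2%:R by apply: val_inj.
have o12 : (1 + 2%:R : 'I_4) = 3%:R by apply: val_inj.
have o22 : (2%:R + 2%:R : 'I_4) = 0 by apply: val_inj.
have o32 : (3%:R + 2%:R : 'I_4) = 1 by apply: val_inj.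
have z (x : R) : x = - x -> x = 0 by lra.
have E10 : M 1 0 = - M 0 1 by have := e 0 0; rewrite !mxE !sum_ord4 !mxE /=; lra.
have E11 : M 1 1 = M 0 0 by have := e 0 1; rewrite !mxE !sum_ord4 !mxE /=; lra.
have E12 : M 0 3%:R = - M 1 2%:R by have := e 0 2%:R; rewrite !mxE !sum_ord4 !mxE /=; lra.
have E21 : M 2%:R 1 = - M 3%:R 0 by have := e 2%:R 0; rewrite !mxE !sum_ord4 !mxE /=; lra.
have := skew 0 0; have := skew 1 1; have := skew 2%:R 2%:R; have := skew 3%:R 3%:R.
have := skew 0 2%:R; have := skew 0 3%:R; have := skew 1 2%:R; have := skew 1 3%:R.
rewrite !(o02, o12, o22, o32) => E33 E32 E23 E22 /z E13 /z E02 /z E31 /z E20.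
exists (M 0 0), (M 0 1), (M 1 2%:R), (M 3%:R 0).
apply/matrixP; apply: ord4P; apply: ord4P; rewrite !mxE //=.
- by rewrite E23 E10 opprK.
- by rewrite E33 E11.
Qed.

Definition block_type (R : realType) (M : 'M[R]_4) : Prop :=
  [\/ M = calJ0 R, M = - calJ0 R
    | exists a x y : R, a ^+ 2 = x * y - 1 /\ M = calJ a x y].

(** With diagonal blocks [p - i q] and [- p - i q] and off-diagonal blocks
    [i u] and [i w], squaring gives [p q = q u = q w = 0]: a nonzero
    [q] kills everything else and must be a sign, whereas [q = 0] leaves the
    noncomplex family. *)
Lemma gacs_block_type (R : realType) (M : 'M[R]_4) :
    M *m calJ0 R = calJ0 R *m M ->
    (forall i j, M (i + 2%:R) j = - M (j + 2%:R) i) ->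
    M *m M = - 1%:M ->
  block_type M.
Proof.
move=> MJ skew; have [p [q [u [w ->]]]] := gacs_matrix_shape MJ skew.
move/matrixP => MM.
have pq : p * q = 0 by have := MM 0 1; rewrite !mxE !sum_ord4 !mxE /=; lra.
have qu : q * u = 0 by have := MM 0 2%:R; rewrite !mxE !sum_ord4 !mxE /=; lra.
have qw : q * w = 0 by have := MM 2%:R 0; rewrite !mxE !sum_ord4 !mxE /=; lra.
have pquw : p ^+ 2 - q ^+ 2 - u * w = -1.
  by have := MM 0 0; rewrite !mxE !sum_ord4 !mxE /=; lra.
have [q0|qn0] := eqVneq q 0.
  constructor 3; exists p, u, w; split; first by move: pquw; rewrite q0; lra.
  by rewrite q0 oppr0.
have q_reg x : q * x = 0 -> x = 0.
  by move/eqP; rewrite mulf_eq0 (negPf qn0) /= => /eqP.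
have p0 : p = 0 by apply: q_reg; rewrite mulrC.
move: pquw; rewrite (q_reg _ qu) (q_reg _ qw) p0 => q2.
have /eqP : q ^+ 2 = 1 by lra.
by rewrite sqrf_eq1 => /orP[] /eqP ->; [constructor 2|constructor 1];
  apply/matrixP; apply: ord4P; apply: ord4P; rewrite !mxE /= ?oppr0 ?opprK.
Qed.

(** The single entry [(0, 2)] of [- M M'] is decisive: it is the value of the
    quadratic form of [G] on a covector, up to a positive factor.  When the
    two matrices have the same type, it vanishes, since the upper right
    block is zero or a multiple of the rotation; in the mixed cases it is the
    sign of the complex one times [x]. *)
Lemma gak_block_pair (R : realType) (M M' : 'M[R]_4) :
    block_type M -> block_type M' -> 0 < (- (M *m M')) 0 2%:R ->
  [\/ M = calJ0 R /\ noncomplex_pos M',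
      noncomplex_pos M /\ M' = calJ0 R,
      M = - calJ0 R /\ noncomplex_neg M'
    | noncomplex_neg M /\ M' = - calJ0 R].
Proof.
case=> [->|->|[a [x [y [axy ->]]]]] [->|->|[a' [x' [y' [axy' ->]]]]];
  rewrite !mxE sum_ord4 !mxE /=; try (by move=> ?; exfalso; lra).
- by move=> p; constructor 1; split=> //; exists a', x', y'; split=> //; lra.
- by move=> p; constructor 3; split=> //; exists a', x', y'; split=> //; lra.
- by move=> p; constructor 2; split=> //; exists a, x, y; split=> //; lra.
- by move=> p; constructor 4; split=> //; exists a, x, y; split=> //; lra.
Qed.

(** * Traces and the Killing form *)

(** [linfun f] is meaningful only when [f] is linear; stating it with a
    plain hypothesis spares a structure instance for each map built from
    [linfun]. *)
Lemma linfunE (R : nzRingType) (aT rT : vectType R) (f : aT -> rT) :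
  linear f -> linfun f =1 f.
Proof.
move=> lf.
pose fM := GRing.isLinear.Build R aT rT _ f lf.
pose F : {linear aT -> rT} := HB.pack f fM.
exact: (lfunE F).
Qed.

Lemma span_ind (K : fieldType) (V : vectType K) (P : V -> Prop) (s : seq V) :
  P 0 -> (forall k u v, P u -> P v -> P (k *: u + v)) ->
  (forall u, u \in s -> P u) -> forall v, v \in <<s>>%VS -> P v.
Proof.
move=> P0 Plin Ps v vs; rewrite (@coord_span _ _ _ (in_tuple s) v vs).
apply: big_rec => [//|i w _ Pw]; apply: Plin => //.
by apply/Ps/mem_nth.
Qed.

Lemma lftrace_basis (K : fieldType) (g : vectType K) n (e : n.-tuple g)
    (f : 'End(g)) : basis_of fullv e ->
  lftrace f = \sum_(i < n) coord e i (f e`_i).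
Proof.
move=> eB; rewrite /lftrace.
under eq_bigr => i _ do rewrite (coord_basis eB (memvf (vbasis fullv)`_i)) !linear_sum.
rewrite exchange_big /=; apply: eq_bigr => j _.
rewrite [in RHS](coord_vbasis (memvf (f e`_j))) linear_sum.
by apply: eq_bigr => i _; rewrite !linearZ /= mulrC.
Qed.

Lemma lftraceC (K : fieldType) (g : vectType K) (f k : 'End(g)) :
  lftrace (f \o k)%VF = lftrace (k \o f)%VF.
Proof.
rewrite /lftrace.
pose c i (v : g) := coord (vbasis fullv) i v.
pose e i := (vbasis (@fullv _ g))`_i.
transitivity (\sum_(i < \dim (@fullv _ g)) \sum_(j < \dim (@fullv _ g))
  c j (k (e i)) * c i (f (e j))).
  apply: eq_bigr => i _; rewrite comp_lfunE [in LHS](coord_vbasis (memvf (k _))) (linear_sum f) linear_sum /=.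
  by apply: eq_bigr => j _; rewrite !linearZ.
rewrite exchange_big; apply: eq_bigr => j _ /=.
rewrite comp_lfunE [in RHS](coord_vbasis (memvf (f _))) (linear_sum k) linear_sum /=.
by apply: eq_bigr => i _; rewrite !linearZ /= mulrC.
Qed.

(** The trace can be computed in any basis, hence in one of eigenvectors. *)
Lemma lftrace_eigen (K : fieldType) (g : vectType K) (f : 'End(g))
    (s : seq g) (l : seq K) :
    basis_of fullv s -> size l = size s ->
    (forall i, (i < size s)%N -> f s`_i = l`_i *: s`_i) ->
  lftrace f = \sum_(x <- l) x.
Proof.
move=> sB sl fs; rewrite (@lftrace_basis _ _ _ (in_tuple s)) //.
rewrite (big_nth 0) big_mkord sl; apply: eq_bigr => i _ /=.
by rewrite fs // linearZ /= (@coord_free _ _ _ (in_tuple s)) ?(basis_free sB) // eqxx mulr1.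
Qed.

Section Killing.
Variables (K : fieldType) (g : vectType K) (br : 'Hom(g, 'End(g))).

Lemma lftraceB (f k : 'End(g)) : lftrace (f - k) = lftrace f - lftrace k.
Proof.
by rewrite /lftrace -sumrB; apply: eq_bigr => i _; rewrite add_lfunE opp_lfunE linearB.
Qed.
Lemma lftraceZ (c : K) (f : 'End(g)) : lftrace (c *: f) = c * lftrace f.
Proof.
by rewrite /lftrace mulr_sumr; apply: eq_bigr => i _; rewrite scale_lfunE linearZ.
Qed.

Lemma killingC x y : killing br x y = killing br y x.
Proof. exact: lftraceC. Qed.

Lemma killingBr x y z : killing br x (y - z) = killing br x y - killing br x z.
Proof. by rewrite /killing linearB /= comp_lfunDr comp_lfunNr lftraceB. Qed.
Lemma killingZr c x y : killing br x (c *: y) = c * killing br x y.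
Proof. by rewrite /killing linearZ /= -comp_lfunZr lftraceZ. Qed.
Lemma killing0r x : killing br x 0 = 0.
Proof. by rewrite -(scale0r 0) killingZr mul0r. Qed.
Lemma killingNr x y : killing br x (- y) = - killing br x y.
Proof. by rewrite -scaleN1r killingZr mulN1r. Qed.
Lemma killingDr x y z : killing br x (y + z) = killing br x y + killing br x z.
Proof. by rewrite -[z]opprK killingBr killingNr !opprK. Qed.

Lemma brDl x y z : br (x + y) z = br x z + br y z.
Proof. by rewrite linearD add_lfunE. Qed.
Lemma brZl c x y : br (c *: x) y = c *: br x y.
Proof. by rewrite linearZ scale_lfunE. Qed.
Lemma brNl x y : br (- x) y = - br x y.
Proof. by rewrite linearN opp_lfunE. Qed.

Hypothesis Hlie : lie_bracket br.

Lemma brC x y : br x y = - br y x.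
Proof.
have [a _] := Hlie; move: (a (x + y)); rewrite (linearD br) /= add_lfunE !linearD /= !a add0r addr0.
by move/eqP; rewrite addr_eq0 => /eqP ->.
Qed.

Lemma br_jacobi x y z : br (br x y) z = br x (br y z) - br y (br x z).
Proof.
have [_ j] := Hlie; have := j x y z.
rewrite (brC z (br x y)) (brC z x) linearN.
by move/eqP; rewrite subr_eq0 => /eqP <-.
Qed.

Lemma ad_br x y : br (br x y) = (br x \o br y)%VF - (br y \o br x)%VF.
Proof.
by apply/lfunP => z; rewrite br_jacobi add_lfunE opp_lfunE !comp_lfunE.
Qed.

Lemma killing_invariant x y z : killing br x (br y z) = killing br (br x y) z.
Proof.
rewrite /killing !ad_br comp_lfunDr comp_lfunDl comp_lfunNl comp_lfunNr !lftraceB.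
by rewrite !comp_lfunA [in X in _ - X]lftraceC !comp_lfunA.
Qed.
End Killing.

(** * The exponential of an endomorphism *)

Section Expend.
Variables (R : realType) (V : vectType R) (D : 'End(V)).

Local Notation n := (\dim (@fullv _ V)).
Local Notation e i := (vbasis (@fullv _ V))`_i.
Local Notation co := (coord (vbasis (@fullv _ V))).

Let N (v : V) : R := \sum_(i < n) `|co i v|.

Let coord_le_norm i v : `|co i v| <= N v.
Proof. by rewrite /N (bigD1 i) //= lerDl sumr_ge0. Qed.

Let norm_apply v : N (D v) <= (\sum_(i < n) N (D (e i))) * N v.
Proof.
rewrite mulr_suml {1}/N (eq_bigr (fun j => `|\sum_(i < n) co i v * co j (D (e i))|)); last first.
  move=> j _; rewrite {1}(coord_vbasis (memvf v)) (linear_sum D) linear_sum /=.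
  by congr `|_|; apply: eq_bigr => i _; rewrite !linearZ.
apply: (@le_trans _ _ (\sum_(j < n) \sum_(i < n) `|co j (D (e i))| * `|co i v|)).
  apply: ler_sum => j _; apply: le_trans (ler_norm_sum _ _ _) _.
  by apply: ler_sum => i _; rewrite normrM mulrC.
rewrite exchange_big; apply: ler_sum => i _ /=.
rewrite -mulr_suml; apply: ler_pM; rewrite ?normr_ge0 ?sumr_ge0 //.
Qed.

(** In the coordinate norm, [D] is bounded by some [C], so the terms are
    dominated by those of the series of [exp C]. *)
Lemma is_cvg_expend i v :
  cvgn (series (fun k => co i (iter k D v) / k`!%:R)).
Proof.
pose C := \sum_(i < n) N (D (e i)).
have C0 : 0 <= C by apply: sumr_ge0 => j _; apply: sumr_ge0.
have bnd k : `|co i (iter k D v)| <= C ^+ k * N v.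
  apply: le_trans (coord_le_norm _ _) _.
  elim: k => [|k IH]; first by rewrite expr0 mul1r.
  rewrite iterS exprS -mulrA; apply: le_trans (norm_apply _) _.
  exact: ler_wpM2l.
apply: normed_cvg.
apply: (@series_le_cvg _ (fun k => `|co i (iter k D v) / k`!%:R|) (fun k => N v * exp_coeff C k)).
- by move=> k.
- by move=> k; rewrite /= mulr_ge0 ?sumr_ge0 // exp_coeff_ge0.
- move=> k /=; rewrite normrM normfV (ger0_norm (ler0n _ _)).
  apply: le_trans (ler_wpM2r _ (bnd k)) _; first by rewrite invr_ge0.
  by rewrite mulrAC mulrC.
- exact/is_cvg_seriesZ/is_cvg_series_exp_coeff.
Qed.

(** Convergence for every vector is what makes the defining function of
    [expend] linear, so that [linfun] returns it unchanged. *)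
Lemma expendE v : expend D v = \sum_(i < n)
  limn (series (fun k => co i (iter k D v) / k`!%:R)) *: e i.
Proof.
rewrite /expend linfunE // => a u w.
rewrite scaler_sumr -big_split; apply: eq_bigr => i _ /=.
rewrite scalerA -scalerDl; congr (_ *: _).
rewrite -[a * _]/(a *: _) -lim_seriesZ; last exact: is_cvg_expend.
rewrite -lim_seriesD; [|exact/is_cvg_seriesZ/is_cvg_expend|exact: is_cvg_expend].
congr (limn (series _)); apply/funext => k.
rewrite /= !fctE.
have -> : iter k D (a *: u + w) = a *: iter k D u + iter k D w.
  by elim: k => //= k ->; rewrite linearP.
by rewrite linearP /= mulrDl -mulrA.
Qed.

(** [iter k D u] is [u] or [w] up to the [k]-th power of [t] and a sign, so
    the exponential series splits into those of cosine and sine. *)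
Lemma expend_rotation (t : R) (u w : V) :
  D u = t *: w -> D w = - t *: u -> expend D u = cos t *: u + sin t *: w.
Proof.
move=> Du Dw.
have itE k : iter k D u = (cos_coeff t k * k`!%:R) *: u
                        + (sin_coeff t k * k`!%:R) *: w.
  have K (x : R) : x / k`!%:R * k`!%:R = x by rewrite divfK // pnatr_eq0 -lt0n fact_gt0.
  rewrite /cos_coeff /sin_coeff /= !{}K.
  elim: k => [|k IH]; first by rewrite /= !mul0r scale0r addr0 expr0 -exprnP expr0 !mulr1 scale1r.
  rewrite iterS IH linearD !linearZ /= Du Dw !scalerA addrC.
  congr (_ *: _ + _ *: _); rewrite exprS -exprnP; last by ring.
  case ok: (odd k); last by rewrite !mul0r.
  have kE : k.-1./2 = k./2 by rewrite -{1}(odd_double_half k) ok /= doubleK.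
  by rewrite uphalf_half ok kE /= add1n exprS; ring.
rewrite expendE [in RHS](coord_vbasis (memvf u)) [in RHS](coord_vbasis (memvf w)).
rewrite !scaler_sumr -big_split; apply: eq_bigr => i _ /=.
rewrite !scalerA -scalerDl; congr (_ *: _).
have -> : cos t = limn (series (cos_coeff t)) by rewrite unlock.
have -> : sin t = limn (series (sin_coeff t)) by rewrite unlock.
rewrite mulrC [X in _ + X]mulrC.
rewrite -[X in _ = X + _]/(_ *: _) -[X in _ = _ + X]/(_ *: _).
rewrite -!lim_seriesZ.
2: exact: is_cvg_series_sin_coeff.
2: exact: is_cvg_series_cos_coeff.
rewrite -lim_seriesD; [|exact/is_cvg_seriesZ/is_cvg_series_cos_coeff
                       |exact/is_cvg_seriesZ/is_cvg_series_sin_coeff].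
congr (limn (series _)); apply/funext => k.
rewrite itE linearD !linearZ !fctE /= mulrDl.
have k0 : k`!%:R != 0 :> R by rewrite pnatr_eq0 -lt0n fact_gt0.
rewrite /GRing.scale /=.
by congr (_ + _); rewrite [RHS]mulrC mulrAC mulfK.
Qed.

End Expend.

(** After scaling by [pi / (|p| + |q|)] both absolute values lie in [0, pi],
    where cosine is injective. *)
Lemma cos_separates (R : realType) (p q : R) : p != q -> p != - q ->
  exists t, cos (t * p) != cos (t * q).
Proof.
move=> pq pnq; set d := `|p| + `|q|.
have d0 : 0 < d.
  rewrite lt0r addr_ge0 // andbT paddr_eq0 // !normr_eq0; apply: contra pq.
  by case/andP => /eqP -> /eqP ->.
have t0 : 0 <= pi / d by rewrite divr_ge0 ?pi_ge0 // ltW.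
have itv (x : R) : `|x| <= d -> pi / d * `|x| \in `[0, pi].
  move=> xd; rewrite in_itv /= mulr_ge0 //= mulrAC ler_pdivrMr //.
  by rewrite ler_wpM2l ?pi_ge0.
exists (pi / d); apply/eqP.
rewrite -cos_norm -[in RHS]cos_norm (normrM _ p) (normrM _ q) (ger0_norm t0).
have pd : `|p| <= d by rewrite lerDl.
have qd : `|q| <= d by rewrite lerDr.
move/(cos_inj (itv _ pd) (itv _ qd)).
have td : pi / d != 0 by rewrite mulf_neq0 ?invr_neq0 ?gt_eqF ?pi_gt0.
move/(mulfI td)/eqP; rewrite eqr_norm2 (negPf pq) (negPf pnq) //.
Qed.

(** * Roots on the torus *)

Section FlagManifold.
Variables (R : realType) (g : vectType R[i]) (br : 'Hom(g, 'End(g))).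
Variables (h : {vspace g}) (Pi : seq (hdual h)) (Hc X : hdual h -> g).
Variable m : hdual h -> hdual h -> R.
Hypotheses (Hlie : lie_bracket br) (Hcartan : cartan_subalgebra br h).
Hypotheses (Hroots : root_set br Pi) (Hduals : root_duals br Pi Hc).
Hypothesis Hweyl : weyl_basis br Pi X m.

Local Notation kf := (killing br).
Local Notation ev b x := ((b : hdual h) (vsproj h x)).

Lemma root_neq0 a : a \in Pi -> a != 0.
Proof. by case: Hroots => _ H /H[]. Qed.

Lemma br_root a y : a \in Pi -> y \in h -> br y (X a) = ev a y *: X a.
Proof.
by case: Hweyl => _ H _ _ _ aPi yh; rewrite -{1}(vsprojK yh) H.
Qed.

Lemma killing_Hc a y : a \in Pi -> y \in h -> kf (Hc a) y = ev a y.
Proof. by move=> aPi yh; have [_ ->] := Hduals aPi; rewrite vsprojK. Qed.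

Lemma Hc_in a : a \in Pi -> Hc a \in h.
Proof. by case/Hduals. Qed.

Lemma ev_HcC a b : a \in Pi -> b \in Pi -> ev a (Hc b) = ev b (Hc a).
Proof.
by move=> aP bP; rewrite -!killing_Hc ?Hc_in // killingC.
Qed.

(** For [z] in the Cartan subalgebra, invariance moves [ad z] from one
    argument to the other: [a z] times the pairing equals [- b z] times it. *)
Lemma killing_weight (a b : hdual h) x y : root_vector br a x -> root_vector br b y ->
  a + b != 0 -> kf x y = 0.
Proof.
move=> ax By /lfunPn[z]; rewrite add_lfunE zero_lfunE => abz.
have: (a z + b z) * kf x y = 0.
  rewrite mulrDl -[b z * _]killingZr -By killingC -killingZr -ax killingC.
  by rewrite killing_invariant // brC // killingC killingNr killingC addNr.
by move/eqP; rewrite mulf_eq0 (negPf abz) => /eqP.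
Qed.

Lemma root_vector_cartan x : x \in h -> root_vector br (0 : hdual h) x.
Proof.
move=> xh z; rewrite zero_lfunE scale0r.
by case: Hcartan => ab _ _; apply: ab => //; exact: subvsP.
Qed.

(** If [- a] were not a root, [X a] would be orthogonal to every vector of the
    basis, yet it pairs to 1 with [X (- a)]. *)
Lemma root_opp a : a \in Pi -> - a \in Pi.
Proof.
move=> aP; case: Hweyl => Bas rv k1 _ _; apply: contraT => naP.
suff : kf (X a) (X (- a)) = 0 by rewrite k1 // => /eqP; rewrite oner_eq0.
have : X (- a) \in <<vbasis h ++ [seq X b | b <- Pi]>>%VS by rewrite (span_basis Bas) memvf.
move: (X (- a)); apply: span_ind.
- exact: killing0r.
- by move=> k u v u0 v0; rewrite killingDr killingZr u0 v0 mulr0 addr0.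
- move=> u; rewrite mem_cat => /orP[uh|/mapP[b bP ->]].
    apply: killing_weight (rv _ aP) (root_vector_cartan (vbasis_mem uh)) _.
    by rewrite addr0 root_neq0.
  apply: killing_weight (rv _ aP) (rv _ bP) _.
  by apply: contra naP; rewrite addrC addr_eq0 => /eqP <-.
Qed.

Lemma killing_cartan y z : y \in h -> z \in h ->
  kf y z = \sum_(c <- Pi) ev c y * ev c z.
Proof.
move=> yh zh; case: Hweyl => Bas rv _ _ _.
(* eigenvalue 0 on the Cartan subalgebra, c(y) c(z) on the line of the root c *)
rewrite /killing (lftrace_eigen (l := nseq (\dim h) 0 ++ [seq ev c y * ev c z | c <- Pi]) Bas).
- rewrite big_cat big_map /= big1_seq ?add0r // => x.
  by rewrite mem_nseq => /andP[_ /andP[_ /eqP]].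
- by rewrite !size_cat !size_map size_nseq size_tuple.
- move=> i ilt; rewrite comp_lfunE !nth_cat size_nseq size_tuple.
  case: ifP => id.
    rewrite nth_nseq id scale0r -[z](vsprojK zh) root_vector_cartan ?zero_lfunE.
      by rewrite scale0r linear0.
    by apply: vbasis_mem; rewrite mem_nth // size_tuple.
  have ip : (i - \dim h < size Pi)%N.
    have hi : (\dim h <= i)%N by rewrite leqNgt id.
    rewrite -(ltn_add2l (\dim h)) subnKC //.
    by move: ilt; rewrite size_cat size_map size_tuple.
  rewrite !(nth_map 0) // br_root ?mem_nth // linearZ /= br_root ?mem_nth //.
  by rewrite scalerA mulrC.
Qed.

(** [[X_a, X_-a]] has weight zero, so adding it to the Cartan subalgebra keeps
    it abelian; conclude by maximality. *)
Lemma coroot_in a : a \in Pi -> br (X a) (X (- a)) \in h.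
Proof.
move=> aP; set t := br _ _; case: (Hcartan) => ab mx _.
have yt y : y \in h -> br y t = 0.
  move=> yh; have naP := root_opp aP.
  have -> : br y t = br (br y (X a)) (X (- a)) + br (X a) (br y (X (- a))).
    by rewrite br_jacobi // subrK.
  rewrite (br_root aP yh) (br_root naP yh).
  rewrite !linearZ /= scale_lfunE -/t -scalerDl.
  by rewrite opp_lfunE addrN scale0r.
have tt : br t t = 0 by case: Hlie => H _; apply: H.
suff E : (h + <[t]>)%VS = h by rewrite -E (subvP (addvSr _ _)) ?memv_line.
apply: mx; first exact: addvSl.
move=> _ _ /memv_addP[u uh [_ /vlineP[k ->] ->]] /memv_addP[w wh [_ /vlineP[l ->] ->]].
rewrite brDl brZl !linearD !linearZ /= tt ab // yt //.
by rewrite (brC Hlie t w) yt // oppr0 !scaler0 !addr0.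
Qed.

(** Pairing with [H_b] and using invariance, [b] takes at [[X_a, X_-a]] the
    value [a (H_b)], which is [b (H_a)] by symmetry. *)
Lemma ev_coroot a b : a \in Pi -> b \in Pi ->
  ev b (br (X a) (X (- a))) = ev b (Hc a).
Proof.
move=> aP bP; case: (Hweyl) => _ _ k1 _ _.
rewrite -killing_Hc ?coroot_in // killing_invariant // br_root ?Hc_in //.
by rewrite killingC killingZr killingC k1 // mulr1 ev_HcC.
Qed.

Local Notation realC := (real_complex R).

Lemma root_vec_neq0 a : a \in Pi -> X a != 0.
Proof.
move=> aP; case: (Hweyl) => _ _ k1 _ _; apply/eqP => X0.
by move: (k1 a aP); rewrite X0 killingC killing0r => /eqP; rewrite eq_sym oner_eq0.
Qed.

Lemma neq_opp_root a : a \in Pi -> a != - a.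
Proof.
move=> aP; apply: contra (root_neq0 aP); rewrite -subr_eq0 opprK => /eqP aa.
have : (2%:R : R[i]) *: a = 0 by rewrite scaler_nat mulr2n.
by move/eqP; rewrite scaler_eq0 pnatr_eq0.
Qed.

Lemma br_br_root c d b : c \in Pi -> d \in Pi -> b \in Pi ->
    c + d = 0 -> d + b != 0 ->
  exists r : R, br (X c) (br (X d) (X b)) = realC r *: X b
             /\ (d + b \notin Pi -> r = 0).
Proof.
move=> cP dP bP cd db; case: (Hweyl) => _ _ _ w4 w5.
have [dbP|dbnP] := boolP (d + b \in Pi).
  exists (m d b * m c (d + b)); split=> //.
  rewrite w4 // linearZ /= w4 //; last by rewrite addrA cd add0r root_neq0.
  by rewrite scalerA addrA cd add0r rmorphM.
exists 0; split=> //; have [_ m0] := w5 _ _ dP bP.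
by rewrite w4 // m0 // rmorph0 !scale0r linear0.
Qed.

(** By Jacobi, [ad [X_a, X_-a]] acts on [X b] through two double brackets whose
    coefficients are products of the real constants [m]; each of them
    vanishes when the intermediate weight is not a root. *)
Lemma ev_coroot_real a b : a \in Pi -> b \in Pi -> b != a -> b != - a ->
  exists r : R, ev b (Hc a) = realC r
    /\ (a + b \notin Pi -> b - a \notin Pi -> r = 0).
Proof.
move=> aP bP ba bna; have naP := root_opp aP.
have [|r [Er r0]] := br_br_root aP naP bP (addrN a).
  by rewrite addrC subr_eq0.
have [|s [Es s0]] := br_br_root naP aP bP (addNr a).
  by rewrite addrC addr_eq0.
exists (r - s); split; last first.
  by move=> abn ban; rewrite r0 ?s0 ?subrr // addrC.
rewrite -(ev_coroot) //.
set t := br _ _; have := br_root bP (coroot_in aP).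
rewrite br_jacobi // Er Es -scalerBl -rmorphB => /eqP.
by rewrite -subr_eq0 -scalerBl scaler_eq0 (negPf (root_vec_neq0 bP)) orbF subr_eq0 => /eqP <-.
Qed.

Lemma sum_roots_pm (F : hdual h -> R[i]) a : a \in Pi ->
  (forall c, c \in Pi -> c != a -> c != - a -> F c = 0) ->
  \sum_(c <- Pi) F c = F a + F (- a).
Proof.
move=> aP F0; have naP := root_opp aP.
have [uPi _] := Hroots.
rewrite (bigD1_seq a) //=; congr (_ + _).
rewrite -big_filter (bigD1_seq (- a)) ?filter_uniq //=; last first.
  by rewrite mem_filter naP eq_sym neq_opp_root.
rewrite big1_seq ?addr0 // => c /andP[cna]; rewrite mem_filter => /andP[ca cP].
exact: F0.
Qed.

(** Let [z = a (H_a)] be nonreal.  Then [2 a] is not a root, since its value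
    [2 z] would be real by the previous lemma.  If some root [c] other than [a], [- a] had
    [c + a] or [c - a] as a root, then [z] would be a difference of the real
    numbers given by that lemma.  Hence all such [c] vanish on [H_a],
    and computing the square norm of [H_a] as a sum over the roots gives
    [z = 2 z^2], whose solutions are real. *)
Lemma ev_coroot_diag_real a : a \in Pi -> complex.Im (ev a (Hc a)) = 0.
Proof.
move=> aP; have naP := root_opp aP.
apply/eqP; apply: contraT => nz.
have nr : forall r, ev a (Hc a) <> realC r.
  by move=> r E; move/eqP: nz; apply; rewrite E.
have hr c : c \in Pi -> c != a -> c != - a ->
    exists r, ev c (Hc a) = realC r.
  by move=> cP ca cna; have [r [E _]] := ev_coroot_real aP cP ca cna; exists r.
have n2a : a + a \notin Pi.
  apply/negP => aaP; have [||r] := hr _ aaP.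
  - by rewrite -subr_eq0 addrK root_neq0.
  - rewrite -subr_eq0 opprK -mulr2n -mulrSr -scaler_nat scaler_eq0 pnatr_eq0 /=.
    exact: (root_neq0 aP).
  rewrite add_lfunE => E; apply: (nr (r / 2)); rewrite rmorphM fmorphV /= -E.
  by rewrite (rmorph_nat realC 2) mulrDl -splitr.
have z0 c : c \in Pi -> c != a -> c != - a -> ev c (Hc a) = 0.
  move=> cP ca cna; have [r [Er r0]] := ev_coroot_real aP cP ca cna.
  rewrite Er r0 ?rmorph0 //.
    apply/negP => acP; have [||s] := hr _ acP.
    - by rewrite -subr_eq0 addrC addKr root_neq0.
    - apply: contra n2a => /eqP E.
      have ce : c = - (a + a) by apply: (addrI a); rewrite E opprD addrA subrr sub0r.
      by rewrite -[a + a]opprK -ce (root_opp).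
    rewrite add_lfunE Er => E; apply: (nr (s - r)).
    by rewrite rmorphB /= -E addrK.
  apply/negP => acP; have [||s] := hr _ acP.
  - by apply: contra n2a; rewrite subr_eq => /eqP <-.
  - rewrite -subr_eq0 opprK subrK; exact: (root_neq0 cP).
  rewrite add_lfunE opp_lfunE Er => E; apply: (nr (r - s)).
  by rewrite rmorphB /= -E opprB addrC subrK.
have : ev a (Hc a) = (ev a (Hc a)) ^+ 2 *+ 2.
  rewrite -{1}(killing_Hc aP (Hc_in aP)).
  rewrite (killing_cartan) ?(Hc_in) //.
  rewrite (sum_roots_pm aP) => [|c cP ca cna]; last by rewrite z0 // mul0r.
  by rewrite opp_lfunE mulrNN -expr2 mulr2n.
set z := ev a (Hc a) => zz.
have z1 : z != 0 by apply/eqP => z00; apply: (nr 0); rewrite -/z z00 rmorph0.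
case: (nr (2^-1)); rewrite -/z fmorphV (rmorph_nat realC 2).
apply: (mulfI z1); apply: (@mulIf _ 2%:R); first by rewrite pnatr_eq0.
by rewrite divfK ?pnatr_eq0 // -expr2 mulr_natr -zz.
Qed.

Lemma ev_Hc_real a b : a \in Pi -> b \in Pi -> complex.Im (ev b (Hc a)) = 0.
Proof.
move=> aP bP; have [->|ba] := eqVneq b a; first exact: ev_coroot_diag_real.
have [->|bna] := eqVneq b (- a).
  rewrite opp_lfunE; have := ev_coroot_diag_real aP.
  by case: (ev a _) => x y /= ->; rewrite oppr0.
by have [r [-> _]] := ev_coroot_real aP bP ba bna.
Qed.

Lemma torus_sub (y : realified g) : y \in torus Hc Pi -> (y : g) \in h.
Proof.
move: y; apply: span_ind => [|k u v uh vh|_ /mapP[c cP ->]].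
- exact: mem0v.
- by apply: rpredD => //; apply: rpredZ.
- by apply: rpredZ; apply: Hc_in _ cP.
Qed.

Lemma ev_torus b (y : realified g) : b \in Pi -> y \in torus Hc Pi ->
  ev b (y : g) = Complex 0 (complex.Im (ev b (y : g))).
Proof.
move=> bP; suff H : y \in torus Hc Pi -> complex.Re (ev b (y : g)) = 0.
  by move=> /H; case: (ev b _) => p q /= ->.
move: y; apply: span_ind => [|k u v uh vh|_ /mapP[c cP ->]].
- by rewrite !linear0.
- have -> : ev b (k *: u + v : g) = realC k * ev b (u : g) + ev b (v : g).
    by rewrite (linearP (vsproj h) (realC k) u v) linearP.
  move: uh vh; case: (ev b u) => p q /= ->; case: (ev b v) => p' q' /= ->.
  by rewrite mulr0 mul0r subrr addr0.
- have -> : ev b (Complex 0 1 *: Hc c) = Complex 0 1 * ev b (Hc c) by rewrite !linearZ.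
  have := ev_Hc_real cP bP; case: (ev b _) => p q /= ->.
  by rewrite mul0r mulr0 subr0.
Qed.

(** On the torus a root [b] is purely imaginary, and [Ad (exp y)] rotates the
    plane of [b] by [angle b y]. *)
Definition angle (b : hdual h) (y : g) : R := complex.Im (ev b y).

Lemma angle_Hc b c : b \in Pi -> c \in Pi ->
  realC (angle b (Complex 0 1 *: Hc c)) = ev b (Hc c).
Proof.
move=> bP cP; rewrite /angle.
have -> : ev b (Complex 0 1 *: Hc c) = Complex 0 1 * ev b (Hc c) by rewrite !linearZ.
have := ev_Hc_real cP bP; case: (ev b _) => p q /= ->.
by rewrite mul0r mul1r add0r.
Qed.

(** By symmetry every root takes the same value on [H_a] and [H_b]; the trace
    formula then identifies the functionals that they represent. *)
Lemma root_eq_of_Hc a b : a \in Pi -> b \in Pi ->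
  (forall c, c \in Pi -> ev a (Hc c) = ev b (Hc c)) -> a = b.
Proof.
move=> aP bP ab; apply/lfunP => y; rewrite -[y]vsvalK.
rewrite -!(killing_Hc) ?subvsP //.
rewrite !(killing_cartan) ?subvsP ?(Hc_in) //.
apply: eq_big_seq => c cP; congr (_ * _).
by rewrite !(ev_HcC cP) // ab.
Qed.

Lemma torus_separates a b : a \in Pi -> b \in Pi -> a != b ->
  exists2 y : realified g, y \in torus Hc Pi & angle a y != angle b y.
Proof.
move=> aP bP ab; have [c cP abc] : exists2 c, c \in Pi & ev a (Hc c) != ev b (Hc c).
  apply/hasP; apply: contraR ab => /hasPn H; apply/eqP/root_eq_of_Hc => // c /H.
  by rewrite negbK => /eqP.
exists (Complex 0 1 *: Hc c : g); first by apply/memv_span/mapP; exists c.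
by apply: contra abc => /eqP E; rewrite -!angle_Hc // E.
Qed.

Lemma angleD b x y : angle b (x + y) = angle b x + angle b y.
Proof. by rewrite /angle !linearD. Qed.

Lemma angleN b y : angle (- b) y = - angle b y.
Proof. by rewrite /angle opp_lfunE; case: (ev b y). Qed.

(** The two conditions exclude two proper subspaces of the torus: a witness of
    one, a witness of the other, or their sum avoids both. *)
Lemma torus_separates_pm a b : a \in Pi -> b \in Pi -> a != b -> a != - b ->
  exists y : realified g, [/\ y \in torus Hc Pi, angle a y != angle b y
    & angle a y != - angle b y].
Proof.
move=> aP bP ab anb; have nbP := root_opp bP.
have [y yT yn] := torus_separates aP bP ab.
have [z zT] := torus_separates aP nbP anb; rewrite angleN => zn.
have [ye|] := eqVneq (angle a y) (- angle b y); last by exists y.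
have [ze|] := eqVneq (angle a z) (angle b z); last by exists z.
exists (y + z : realified g); split; first exact: rpredD.
  by rewrite !angleD ze (inj_eq (addIr _)).
by rewrite !angleD ye opprD (inj_eq (addrI _)).
Qed.

(** * The basis of the tangent space and its dual *)

Variables (Sigma Pip : seq (hdual h)) (H : g).
Hypothesis Hpos : positive_system Pi Sigma Pip.
Hypotheses (Htorus : (H : realified g) \in torus Hc Pi) (Hreg : regular Pi H).

Local Notation V := (subvs_of (nminus X Pip)).
Local Notation iC := (Complex 0 1 : R[i]).

Lemma pos_root a : a \in Pip -> a \in Pi.
Proof. by case: Hpos => _ _ _ _ P /P[]. Qed.

(** The coordinates of [a + b] on the simple system are sums of natural
    numbers; if they vanish, so do those of [a]. *)
Lemma pos_add_neq0 a b : a \in Pip -> b \in Pip -> a + b != 0.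
Proof.
case: Hpos => fS _ _ _ P aP bP; apply/eqP => ab0.
have [c ca] : nat_comb Sigma a by case/P: aP.
have [d db] : nat_comb Sigma b by case/P: bP.
have /eqP := root_neq0 (pos_root aP); apply; rewrite ca.
have /freeP fz : free (in_tuple Sigma) by [].
have bn (F : hdual h -> hdual h) : \sum_(s <- Sigma) F s = \sum_(i < size Sigma) F Sigma`_i.
  by rewrite (big_nth 0) big_mkord.
have E : \sum_(i < size Sigma) ((addn (c Sigma`_i) (d Sigma`_i))%:R : R[i]) *: (in_tuple Sigma)`_i = 0.
  apply: etrans ab0; rewrite [in RHS]ca [in RHS]db !bn -big_split; apply: eq_bigr => i _ /=.
  by rewrite scaler_nat mulrnDr.
rewrite bn big1 // => i _.
by have /eqP := fz _ E i; rewrite pnatr_eq0 addn_eq0 => /andP[/eqP -> _].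
Qed.

Lemma ev_H a : a \in Pi -> ev a H = Complex 0 (angle a H).
Proof. by move=> aP; rewrite (ev_torus aP Htorus). Qed.

Lemma angle_H_neq0 a : a \in Pi -> angle a H != 0.
Proof. by move=> aP; apply: contra (Hreg aP); rewrite ev_H // => /eqP ->. Qed.

Lemma killing_roots u v : u \in Pi -> v \in Pi ->
  kf H (br (X u) (X v)) = if u + v == 0 then ev u H else 0.
Proof.
move=> uP vP; have [_ rv k1 _ _] := Hweyl.
have Hh := torus_sub Htorus.
rewrite killing_invariant // (br_root) // killingC killingZr killingC.
case: eqVneq => [uv|uv]; last by rewrite (killing_weight (rv _ uP) (rv _ vP)) ?mulr0.
by have -> : v = - u; [apply/eqP; rewrite -addr_eq0 addrC uv|rewrite k1 ?mulr1].
Qed.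

Lemma pos_pairings a b : a \in Pip -> b \in Pip ->
  [/\ kf H (br (X a) (X b)) = 0,
      kf H (br (X a) (X (- b))) = (if a == b then ev a H else 0),
      kf H (br (X (- a)) (X b)) = (if a == b then - ev a H else 0) &
      kf H (br (X (- a)) (X (- b))) = 0].
Proof.
move=> aP bP; have ab := pos_add_neq0 aP bP.
have [aPi bPi] := (pos_root aP, pos_root bP).
have [naP nbP] := (root_opp aPi, root_opp bPi).
rewrite !killing_roots // (negPf ab) subr_eq0 -opprD oppr_eq0 (negPf ab).
by rewrite addrC subr_eq0 opp_lfunE [b == a]eq_sym.
Qed.

(** [omega] only pairs a root vector with its opposite, so that at most two of
    the four terms survive.  They cancel between two vectors [A] or two vectors
    [S], and add up in [omega (A_a, S_a)]. *)
Lemma omega_AA a b : a \in Pip -> b \in Pip ->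
  kf H (br (Avec X a) (Avec X b)) = 0.
Proof.
move=> aP bP; have [e1 e2 e3 e4] := pos_pairings aP bP.
rewrite /Avec brDl brNl !linearB /= !(killingDr, killingBr, killingNr) e1 e2 e3 e4.
by case: ifP => _; rewrite ?opprK; ring.
Qed.

Lemma omega_SS a b : a \in Pip -> b \in Pip ->
  kf H (br (Svec X a) (Svec X b)) = 0.
Proof.
move=> aP bP; have [e1 e2 e3 e4] := pos_pairings aP bP.
rewrite /Svec brZl linearZ /= brDl !linearD /= !(killingZr, killingDr) e1 e2 e3 e4.
by case: ifP => _; ring.
Qed.

Lemma omega_AS a b : a \in Pip -> b \in Pip ->
  kf H (br (Avec X a) (Svec X b)) = if a == b then 2 * iC * ev a H else 0.
Proof.
move=> aP bP; have [e1 e2 e3 e4] := pos_pairings aP bP.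
rewrite /Avec /Svec linearZ /= brDl brNl !linearD /= !(killingZr, killingDr, killingNr) e1 e2 e3 e4.
by case: ifP => _; ring.
Qed.

Lemma kcoefE a : a \in Pi -> kcoef br Hc H a = (2 * iC * ev a H)^-1.
Proof. by move=> aP; rewrite /kcoef killingC (killing_Hc) ?(torus_sub Htorus). Qed.

(** The constant [k_a] is chosen to normalise [k_a omega (A_a, S_a)] to 1. *)
Lemma kcoefK a : a \in Pi -> kcoef br Hc H a * (2 * iC * ev a H) = 1.
Proof.
move=> aP; rewrite kcoefE // mulVf // !mulf_neq0 ?Hreg ?pnatr_eq0 //.
by rewrite eq_complex /= oner_eq0 andbF.
Qed.

Lemma realified_lin (f : {linear g -> g}) : linear (f : realified g -> realified g).
Proof. by move=> k u v; exact: (linearP f (realC k) u v). Qed.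

Lemma starE a x (v : V) :
  star br Pip Hc X H a x v = complex.Re (kcoef br Hc H a * kf H (br x (vsval v : g))).
Proof.
rewrite /star linfunE // => k u w /=.
have -> : br x (vsval (k *: u + w) : g) = realC k *: br x (vsval u : g) + br x (vsval w : g).
  have -> : vsval (k *: u + w) = k *: vsval u + vsval w by exact: linearP.
  exact: (linearP (br x) (realC k) (vsval u : g) (vsval w : g)).
rewrite killingDr killingZr mulrDr mulrCA linearD /=; congr (_ + _).
by case: (_ * kf _ _) => p q /=; rewrite mul0r subr0.
Qed.

Definition vecA a : V := vsproj (nminus X Pip) (Avec X a : realified g).
Definition vecS a : V := vsproj (nminus X Pip) (Svec X a : realified g).
Definition dualA a : vdual V := - star br Pip Hc X H a (Svec X a).
Definition dualS a : vdual V := star br Pip Hc X H a (Avec X a).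

Lemma ualpha_sub a : a \in Pip -> (ualpha X a <= nminus X Pip)%VS.
Proof. by move=> aP; rewrite /nminus (big_rem a) //= addvSl. Qed.

Lemma val_vecA a : a \in Pip -> vsval (vecA a) = Avec X a.
Proof.
by move=> aP; rewrite vsprojK // (subvP (ualpha_sub aP)) // memv_span // inE eqxx.
Qed.
Lemma val_vecS a : a \in Pip -> vsval (vecS a) = Svec X a.
Proof.
by move=> aP; rewrite vsprojK // (subvP (ualpha_sub aP)) // memv_span // !inE eqxx orbT.
Qed.

Lemma nminus_ind (P : V -> Prop) :
  P 0 -> (forall k u v, P u -> P v -> P (k *: u + v)) ->
  (forall a, a \in Pip -> P (vecA a) /\ P (vecS a)) -> forall v, P v.
Proof.
move=> P0 Pl PAS v; rewrite -[v]vsvalK; move: (subvsP v); move: (vsval v) => {v}.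
suff F (s : seq (hdual h)) : {subset s <= Pip} -> forall y,
    y \in (\sum_(a <- s) ualpha X a)%VS -> P (vsproj (nminus X Pip) y) by exact: F.
elim: s => [_ y|a s IH sP y].
  by rewrite big_nil memv0 => /eqP ->; rewrite linear0.
rewrite big_cons => /memv_addP[u ua [w ws ->]].
have aP : a \in Pip by rewrite sP ?mem_head.
rewrite linearD /= -[X in X + _]scale1r; apply: (Pl 1); last first.
  by apply: IH => // c cs; rewrite sP // inE cs orbT.
move: u ua; apply: span_ind => [|k u v Pu Pv|u].
- by rewrite linear0.
- by rewrite linearP; apply: Pl.
- by rewrite !inE => /orP[] /eqP ->; have [] := PAS a aP.
Qed.

Lemma nminus_ext (f f' : vdual V) :
  (forall a, a \in Pip -> f (vecA a) = f' (vecA a) /\ f (vecS a) = f' (vecS a)) -> f = f'.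
Proof.
move=> ff'; apply/lfunP; apply: nminus_ind => //; first by rewrite !linear0.
by move=> k u v e1 e2; rewrite !linearP /= e1 e2.
Qed.

(** The two families of functionals and the two families of vectors are dual;
    in particular this proves the vectors independent. *)
Lemma dualE a b : a \in Pip -> b \in Pip ->
  [/\ dualA a (vecA b) = (a == b)%:R, dualA a (vecS b) = 0,
      dualS a (vecA b) = 0 & dualS a (vecS b) = (a == b)%:R].
Proof.
move=> aP bP; rewrite /dualA /dualS !opp_lfunE !starE val_vecA // val_vecS //.
rewrite omega_AA // omega_SS // omega_AS // brC // killingNr omega_AS // [b == a]eq_sym.
rewrite mulr0 oppr0 mulrN linearN opprK.
case: eqVneq => [->|_]; last by rewrite !mulr0.
by rewrite kcoefK ?pos_root //.
Qed.

Lemma nminus_decomp (v : V) :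
  v = \sum_(a <- Pip) (dualA a v *: vecA a + dualS a v *: vecS a).
Proof.
have uP : uniq Pip by case: Hpos.
move: v; apply: nminus_ind.
- by rewrite big1 // => a _; rewrite !linear0 !scale0r addr0.
- move=> k u v {1}-> {1}->; rewrite scaler_sumr -big_split; apply: eq_bigr => a _ /=.
  rewrite (linearP (dualA a)) (linearP (dualS a)) /= !scalerDl scalerDr !scalerA.
  exact: addrACA.
- move=> a aP; split; rewrite (bigD1_seq a) //= big1_seq ?addr0.
  + by have [-> _ -> _] := dualE aP aP; rewrite eqxx scale1r scale0r addr0.
  + move=> b /andP[ba bP]; have [-> _ -> _] := dualE bP aP.
    by rewrite (negPf ba) !scale0r addr0.
  + by have [_ -> _ ->] := dualE aP aP; rewrite eqxx scale1r scale0r add0r.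
  + move=> b /andP[ba bP]; have [_ -> _ ->] := dualE bP aP.
    by rewrite (negPf ba) !scale0r addr0.
Qed.

(** * The pairing in the basis *)

Definition gbase a (i : 'I_4) : gtan V := tnth (gbasis br Pip Hc X H a) i.

Lemma gbase0 a : gbase a 0 = (vecA a, 0). Proof. by []. Qed.
Lemma gbase1 a : gbase a 1 = (vecS a, 0). Proof. by []. Qed.
Lemma gbase2 a : gbase a 2%:R = (0, dualA a). Proof. by []. Qed.
Lemma gbase3 a : gbase a 3%:R = (0, dualS a). Proof. by []. Qed.
Definition gbaseE := (gbase0, gbase1, gbase2, gbase3).

Lemma gpairC (v w : gtan V) : gpair v w = gpair w v.
Proof. by rewrite /gpair addrC. Qed.
Lemma gpair_linear v : linear (gpair v : gtan V -> R^o).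
Proof.
move=> k u w; rewrite /gpair /= add_lfunE scale_lfunE.
have -> : v.2 (k *: u.1 + w.1) = k * v.2 u.1 + v.2 w.1 by rewrite linearP.
rewrite -[_ *: (2^-1 * _)]/(_ * _) -[k *: _]/(k * _); ring.
Qed.
Lemma gpairDr (v u w : gtan V) : gpair v (u + w) = gpair v u + gpair v w.
Proof. by have := gpair_linear v 1 u w; rewrite !scale1r. Qed.
Lemma gpair0r (v : gtan V) : gpair v 0 = 0.
Proof. by apply: (addIr (gpair v 0)); rewrite -gpairDr !add0r. Qed.
Lemma gpairZr k (v u : gtan V) : gpair v (k *: u) = k * gpair v u.
Proof. by rewrite -[k *: u]addr0 gpair_linear gpair0r addr0. Qed.
Lemma gpairDl (v u w : gtan V) : gpair (u + w) v = gpair u v + gpair w v.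
Proof. by rewrite !(gpairC _ v) gpairDr. Qed.
Lemma gpairZl k (v u : gtan V) : gpair (k *: u) v = k * gpair u v.
Proof. by rewrite !(gpairC _ v) gpairZr. Qed.
Lemma gpairNr (v u : gtan V) : gpair v (- u) = - gpair v u.
Proof. by rewrite -scaleN1r gpairZr mulN1r. Qed.
Lemma gpairNl (v u : gtan V) : gpair (- u) v = - gpair u v.
Proof. by rewrite !(gpairC _ v) gpairNr. Qed.

Lemma gpair_gbase a b i j : a \in Pip -> b \in Pip ->
  gpair (gbase a i) (gbase b j) = 2^-1 * ((a == b) && (j == i + 2%:R))%:R.
Proof.
move=> aP bP; have [a1 a2 a3 a4] := dualE aP bP; have [b1 b2 b3 b4] := dualE bP aP.
move: j; apply: ord4P; move: i; apply: ord4P; rewrite /gpair !gbaseE /= ?linear0 ?zero_lfunE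
  ?a1 ?a2 ?a3 ?a4 ?b1 ?b2 ?b3 ?b4 ?addr0 ?add0r ?andbF ?andbT ?[b == a]eq_sym //.
Qed.

Lemma gpair_nondeg (w : gtan V) :
  (forall b i, b \in Pip -> gpair w (gbase b i) = 0) -> w = 0.
Proof.
case: w => v xi w0.
have half (x : R) : 2^-1 * x = 0 -> x = 0.
  by move/eqP; rewrite mulf_eq0 invr_eq0 pnatr_eq0 => /eqP.
have v0 : v = 0.
  rewrite [v]nminus_decomp big1_seq // => b /= bP.
  have := w0 b 2%:R bP; have := w0 b 3%:R bP.
  rewrite /gpair !gbaseE /= linear0 !add0r ?addr0 => /half -> /half ->.
  by rewrite !scale0r addr0.
congr (_, _); rewrite ?v0 //; apply: nminus_ext => b bP; have := w0 b 0 bP; have := w0 b 1 bP.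
by rewrite /gpair !gbaseE /= !zero_lfunE !addr0 => /half -> /half ->.
Qed.

(** * The action of the torus *)

Section Torus.
Variable y : g.
Hypothesis yT : (y : realified g) \in torus Hc Pi.

Definition adr : 'End(realified g) := linfun (br y : realified g -> realified g).

Lemma adrE u : adr u = br y u.
Proof. by rewrite /adr linfunE //; exact: realified_lin. Qed.

Lemma br_X a : a \in Pi -> br y (X a) = Complex 0 (angle a y) *: X a.
Proof.
move=> aP; rewrite (br_root aP (torus_sub yT)).
by rewrite (ev_torus aP yT).
Qed.

Lemma adr_A a : a \in Pi -> adr (Avec X a) = angle a y *: (Svec X a : realified g).
Proof.
move=> aP; have naP := root_opp aP.
rewrite adrE -[RHS]/(realC _ *: (Svec X a : g)) /Avec /Svec linearB /= !br_X //.
rewrite angleN scalerA.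
have -> : realC (angle a y) * iC = Complex 0 (angle a y).
  by apply/eqP; rewrite eq_complex /= !mulr0 !mul0r mulr1 subr0 addr0 !eqxx.
have -> : Complex 0 (- angle a y) = - Complex 0 (angle a y) :> R[i].
  by apply/eqP; rewrite eq_complex /= oppr0 !eqxx.
by rewrite scaleNr opprK scalerDr.
Qed.

Lemma adr_S a : a \in Pi -> adr (Svec X a) = - angle a y *: (Avec X a : realified g).
Proof.
move=> aP; have naP := root_opp aP.
rewrite adrE -[RHS]/(realC _ *: (Avec X a : g)) /Avec /Svec linearZ linearD /= !br_X //.
rewrite angleN.
have -> : Complex 0 (- angle a y) = - Complex 0 (angle a y) :> R[i].
  by apply/eqP; rewrite eq_complex /= oppr0 !eqxx.
rewrite scaleNr -scalerBr scalerA.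
suff -> : iC * Complex 0 (angle a y) = realC (- angle a y) by [].
by apply/eqP; rewrite eq_complex /= !mulr0 !mul0r mul1r sub0r addr0 !eqxx.
Qed.

Lemma AdTE (v : V) : AdT br Pip X y v =
  vsproj (nminus X Pip) (expend adr (vsval v)).
Proof. by rewrite /AdT linfunE // => k u w; rewrite !linearP. Qed.

Lemma AdT_A a : a \in Pip ->
  AdT br Pip X y (vecA a) = cos (angle a y) *: vecA a + sin (angle a y) *: vecS a.
Proof.
move=> aP; have aPi := pos_root aP.
rewrite AdTE val_vecA // (expend_rotation (adr_A aPi) (adr_S aPi)).
by rewrite linearD !linearZ.
Qed.

Lemma AdT_S a : a \in Pip ->
  AdT br Pip X y (vecS a) = cos (angle a y) *: vecS a - sin (angle a y) *: vecA a.
Proof.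
move=> aP; have aPi := pos_root aP.
have AS : adr (Avec X a) = - - angle a y *: (Svec X a : realified g).
  by rewrite opprK adr_A.
rewrite AdTE val_vecS // (expend_rotation (adr_S aPi) AS) cosN sinN scaleNr.
by rewrite linearB !linearZ.
Qed.

End Torus.

Lemma torusN (y : realified g) : y \in torus Hc Pi -> - y \in torus Hc Pi.
Proof. exact: rpredNr. Qed.

Lemma angleNr (b : hdual h) (y : g) : angle b (- y) = - angle b y.
Proof. by rewrite /angle !linearN. Qed.

Definition rot b (i : 'I_4) : gtan V := \sum_(k < 4) calJ0 R k i *: gbase b k.

Lemma rot0 b : rot b 0 = gbase b 1.
Proof. by rewrite /rot sum_ord4 !mxE /= !scale0r scale1r add0r !addr0. Qed.
Lemma rot1 b : rot b 1 = - gbase b 0.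
Proof. by rewrite /rot sum_ord4 !mxE /= !scale0r scaleN1r !addr0. Qed.
Lemma rot2 b : rot b 2%:R = gbase b 3%:R.
Proof. by rewrite /rot sum_ord4 !mxE /= !scale0r scale1r !add0r. Qed.
Lemma rot3 b : rot b 3%:R = - gbase b 2%:R.
Proof. by rewrite /rot sum_ord4 !mxE /= !scale0r scaleN1r !add0r addr0. Qed.

Lemma AdT_dualA y b : (y : realified g) \in torus Hc Pi -> b \in Pip ->
  (dualA b \o AdT br Pip X (- y))%VF = cos (angle b y) *: dualA b + sin (angle b y) *: dualS b.
Proof.
move=> yT bP; apply: nminus_ext => c cP; have [d1 d2 d3 d4] := dualE bP cP.
rewrite !comp_lfunE !(AdT_A (torusN yT)) // !(AdT_S (torusN yT)) // !angleNr cosN sinN.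
rewrite !add_lfunE !scale_lfunE !(linearB, linearD) !linearZ /= d1 d2 d3 d4.
rewrite -![_ *: _]/(_ * _).
by case: eqVneq => [->|_] /=; split; ring.
Qed.

Lemma AdT_dualS y b : (y : realified g) \in torus Hc Pi -> b \in Pip ->
  (dualS b \o AdT br Pip X (- y))%VF = cos (angle b y) *: dualS b - sin (angle b y) *: dualA b.
Proof.
move=> yT bP; apply: nminus_ext => c cP; have [d1 d2 d3 d4] := dualE bP cP.
rewrite !comp_lfunE !(AdT_A (torusN yT)) // !(AdT_S (torusN yT)) // !angleNr cosN sinN.
rewrite !add_lfunE !opp_lfunE !scale_lfunE !(linearB, linearD) !linearZ /= d1 d2 d3 d4.
rewrite -![_ *: _]/(_ * _).
by case: eqVneq => [->|_] /=; split; ring.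
Qed.

Lemma gtan_comb (k l : R) (v v' : V) (f f' : vdual V) :
  k *: ((v, f) : gtan V) + l *: ((v', f') : gtan V) = (k *: v + l *: v', k *: f + l *: f').
Proof. by []. Qed.

Lemma gtan_opp (v : V) (f : vdual V) : - ((v, f) : gtan V) = (- v, - f).
Proof. by []. Qed.

(** The torus rotates the two planes of a block by the same angle, because the
    contragredient of a rotation is the same rotation in the dual basis. *)
Lemma AdTg_gbase y b i : (y : realified g) \in torus Hc Pi -> b \in Pip ->
  AdTg br y (gbase b i) = cos (angle b y) *: gbase b i + sin (angle b y) *: rot b i.
Proof.
move=> yT bP; move: i; apply: ord4P;
  rewrite ?rot0 ?rot1 ?rot2 ?rot3 /AdTg !gbaseE ?gtan_opp gtan_comb /=
    ?comp_lfun0l ?(linear0 (AdT br Pip X y)) ?oppr0 !scaler0 addr0.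
- by rewrite AdT_A.
- by rewrite AdT_S // scalerN.
- by rewrite AdT_dualA.
- by rewrite AdT_dualS // [in RHS]scalerN.
Qed.

(** The contragredient action on the dual makes the adjoint of [Ad (exp y)]
    for the pairing equal to [Ad (exp (- y))], straight from the definition. *)
Lemma AdTg_adj (y : g) (v w : gtan V) :
  gpair (AdTg br y v) w = gpair v (AdTg br (- y) w).
Proof. by rewrite /gpair /AdTg /= !comp_lfunE /= opprK. Qed.

Lemma AdTg_linear (y : g) : linear (AdTg br y : gtan V -> gtan V).
Proof.
move=> k [v f] [w f']; rewrite /AdTg /= linearP comp_lfunDl -comp_lfunZl.
by [].
Qed.

Lemma angleZ (b : hdual h) (t : R) (y : realified g) :
  angle b (t *: y) = t * angle b y.
Proof.
rewrite /angle; have -> : vsproj h (t *: y : realified g) = realC t *: vsproj h y by exact: linearZ.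
by rewrite linearZ /=; case: (b _) => p q /=; rewrite mul0r addr0.
Qed.

(** * The blocks of an invariant structure *)

Definition gcoord a i (w : gtan V) : R := 2 * gpair w (gbase a (i + 2%:R)).

Lemma gcoord_sum a (c : 'I_4 -> R) i : a \in Pip ->
  gcoord a i (\sum_k c k *: gbase a k) = c i.
Proof.
move=> aP; rewrite /gcoord sum_ord4 !gpairDl !gpairZl !gpair_gbase // eqxx /=.
by move: i; apply: ord4P; rewrite /= !mulr0 !mulr1; field.
Qed.

Lemma component_inj (f : 'End(gtan V)) a M N : a \in Pip ->
  component_is br Hc H f a M -> component_is br Hc H f a N -> M = N.
Proof.
move=> aP fM fN; apply/matrixP => i j.
by rewrite -(gcoord_sum (fun k => M k j) i aP) -fM fN gcoord_sum.
Qed.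

Lemma component_comp (f f' : 'End(gtan V)) a M N :
  component_is br Hc H f a M -> component_is br Hc H f' a N ->
  component_is br Hc H (f \o f')%VF a (M *m N).
Proof.
move=> fM fN j; rewrite comp_lfunE fN linear_sum.
transitivity (\sum_(k < 4) \sum_(i < 4) (N k j * M i k) *: gbase a i).
  by apply: eq_bigr => k _; rewrite linearZ /= fM scaler_sumr; apply: eq_bigr => i _; rewrite scalerA.
rewrite exchange_big; apply: eq_bigr => i _; rewrite mxE scaler_suml.
by apply: eq_bigr => k _; rewrite mulrC.
Qed.

Section Gacs.
Variable J : 'End(gtan V).
Hypothesis HJ : invariant_gacs br Pi Hc J.

Lemma gacs_skew v w : gpair (J v) w = - gpair v (J w).
Proof.
have [iso JJ _] := HJ.
have JJw : J (J w) = - w by rewrite -comp_lfunE JJ opp_lfunE id_lfunE.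
by rewrite -(iso v (J w)) JJw gpairNr opprK.
Qed.

(** [J] commutes with [T = Ad (exp z) + Ad (exp (- z))], which is selfadjoint
    and acts on the block of [b] as the scalar [2 cos (angle b z)].  The torus
    contains some [z] giving [a] and [b] different cosines, so [J],
    which preserves the eigenspaces of [T], has no entry between the blocks. *)
Lemma gacs_split a b i j : a \in Pip -> b \in Pip -> a != b ->
  gpair (J (gbase a i)) (gbase b j) = 0.
Proof.
move=> aP bP ab; have [_ _ comm] := HJ.
have anb : a != - b by rewrite -addr_eq0 pos_add_neq0.
have [y [yT yab yanb]] := torus_separates_pm
  (pos_root aP) (pos_root bP) ab anb.
have [t tc] := cos_separates yab yanb.
set z : realified g := t *: y.
have zT : z \in torus Hc Pi by rewrite rpredZ.
pose T (v : gtan V) := AdTg br z v + AdTg br (- z) v.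
have Tgb c k : c \in Pip -> T (gbase c k) = (2 * cos (t * angle c y)) *: gbase c k.
  move=> cP; rewrite /T !AdTg_gbase ?torusN // angleNr cosN sinN /z angleZ.
  by rewrite scaleNr addrACA addrN addr0 -scalerDl mulr_natl mulr2n.
have Tadj v w : gpair (T v) w = gpair v (T w).
  by rewrite /T gpairDl gpairDr !AdTg_adj opprK addrC.
have JZ k v : J (k *: v) = k *: J v by exact: linearZ.
have TJ v : J (T v) = T (J v) by rewrite /T linearD /= !comm ?torusN.
have : (2 * cos (t * angle a y) - 2 * cos (t * angle b y)) * gpair (J (gbase a i)) (gbase b j) = 0.
  rewrite mulrBl -gpairZl -gpairZr -(Tgb b) // -Tadj -TJ (Tgb a) //.
  by rewrite JZ subrr.
move/eqP; rewrite -mulrBr mulf_eq0 mulf_eq0 pnatr_eq0 subr_eq0 (negPf tc) /=.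
by move/eqP.
Qed.

Definition block a : 'M[R]_4 := \matrix_(i, j) gcoord a i (J (gbase a j)).

Lemma blockP a : a \in Pip -> component_is br Hc H J a (block a).
Proof.
move=> aP; suff E j : J (gbase a j) = \sum_(i < 4) block a i j *: gbase a i by exact: E.
apply/eqP; rewrite -subr_eq0; apply/eqP; apply: gpair_nondeg => b i bP; rewrite gpairDl gpairNl.
have [ab|ab] := eqVneq a b; last first.
  rewrite gacs_split // sum_ord4 !gpairDl !gpairZl !gpair_gbase // (negPf ab).
  by rewrite /= !(mulr0, addr0, oppr0).
subst b; apply/eqP; rewrite subr_eq0; apply/eqP.
have := gcoord_sum (fun k => block a k j) (i + 2%:R) aP.
rewrite /gcoord ord4_add2K mxE /gcoord ord4_add2K => /mulfI -> //.
by rewrite pnatr_eq0.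
Qed.

Lemma block_skew a i j : block a (i + 2%:R) j = - block a (j + 2%:R) i.
Proof.
by rewrite !mxE /gcoord !ord4_add2K gacs_skew mulrN gpairC.
Qed.

Lemma block_sqr a : a \in Pip -> block a *m block a = - 1%:M.
Proof.
move=> aP; apply: (component_inj aP (component_comp (blockP aP) (blockP aP))).
have [_ -> _] := HJ; move=> j; rewrite opp_lfunE id_lfunE (bigD1 j) //= big1 ?addr0.
  by rewrite !mxE eqxx scaleN1r.
by move=> i ij; rewrite !mxE (negPf ij) oppr0 scale0r.
Qed.

(** A multiple of [H] turns the block of [a] by a quarter turn, whose matrix
    is [calJ0]; regularity of [H] makes the multiple available. *)
Lemma block_comm a : a \in Pip -> block a *m calJ0 R = calJ0 R *m block a.
Proof.
move=> aP; have [_ _ comm] := HJ; have aPi := pos_root aP.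
set z : realified g := (pi / 2 / angle a H) *: (H : realified g).
have zT : z \in torus Hc Pi by rewrite rpredZ.
have za : angle a z = pi / 2 by rewrite /z angleZ divfK // angle_H_neq0.
pose A : 'End(gtan V) := linfun (AdTg br z : gtan V -> gtan V).
have AE v : A v = AdTg br z v by rewrite /A linfunE //; exact: AdTg_linear.
have Aa : component_is br Hc H A a (calJ0 R).
  move=> j; rewrite AE -/(gbase a j) AdTg_gbase // za cos_pihalf sin_pihalf.
  by rewrite scale0r add0r scale1r.
apply: (component_inj aP (component_comp (blockP aP) Aa)).
have -> : (J \o A = A \o J)%VF.
  by apply/lfunP => v; rewrite !comp_lfunE !AE comm.
exact: component_comp Aa (blockP aP).
Qed.

Lemma gacs_block a : a \in Pip -> block_type (block a).
Proof.
move=> aP; apply: gacs_block_type (block_comm aP) _ (block_sqr aP).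
exact: block_skew.
Qed.

End Gacs.

(** Positivity of [G] on the covector dual to [A_a], the third basis vector. *)
Lemma gak_diag (J J' : 'End(gtan V)) (a : hdual h) :
    invariant_gak br Pi Hc J J' -> a \in Pip ->
  0 < (- (block J a *m block J' a)) 0 2%:R.
Proof.
move=> [HJ HJ' _ Gpos] aP.
have := Gpos (gbase a 2%:R); have -> : gbase a 2%:R != 0.
  apply/eqP => g0; have := gpair_gbase 0 2%:R aP aP.
  by rewrite g0 gpair0r eqxx /= mulr1 => /eqP; rewrite eq_sym invr_eq0 pnatr_eq0.
have JJ' : (J \o J')%VF (gbase a 2%:R) = \sum_i (block J a *m block J' a) i 2%:R *: gbase a i.
  exact: component_comp (blockP HJ aP) (blockP HJ' aP) _.
move=> /(_ isT); rewrite opp_lfunE JJ' gpairNl.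
rewrite sum_ord4 !gpairDl !gpairZl !gpair_gbase // eqxx /= [in X in _ -> X]mxE.
by move: ((_ *m _) 0 _) => z; lra.
Qed.

End FlagManifold.

Theorem corollary6p4 (R : realType) (g : vectType R[i])
    (br : 'Hom(g, 'End(g))) (h : {vspace g})
    (Pi Sigma Pip : seq (hdual h)) (Hc X : hdual h -> g)
    (m : hdual h -> hdual h -> R) (H : g)
    (Hlie : lie_bracket br) (Hss : lie_semisimple br)
    (Hcartan : cartan_subalgebra br h)
    (Hroots : root_set br Pi)
    (Hpos : positive_system Pi Sigma Pip)
    (Hduals : root_duals br Pi Hc)
    (Hweyl : weyl_basis br Pi X m)
    (Htorus : (H : realified g) \in torus Hc Pi)
    (Hreg : regular Pi H)
    (J J' : 'End(gtan (subvs_of (nminus X Pip))))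
    (HJ : invariant_gak br Pi Hc J J')
    (a : hdual h) (Ha : a \in Pip) :
  exists M M' : 'M[R]_4,
    [/\ component_is br Hc H J a M,
        component_is br Hc H J' a M'
      & [\/ M = calJ0 R /\ noncomplex_pos M',
            noncomplex_pos M /\ M' = calJ0 R,
            M = - calJ0 R /\ noncomplex_neg M'
          | noncomplex_neg M /\ M' = - calJ0 R]].
Proof.
have [gJ gJ' _ _] := HJ.
exists (block br Hc H J a), (block br Hc H J' a); split.
- exact: (blockP Hlie Hcartan Hroots Hduals Hweyl Hpos Htorus Hreg gJ Ha).
- exact: (blockP Hlie Hcartan Hroots Hduals Hweyl Hpos Htorus Hreg gJ' Ha).
apply: gak_block_pair.
- exact: (gacs_block Hlie Hcartan Hroots Hduals Hweyl Hpos Htorus Hreg gJ Ha).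
- exact: (gacs_block Hlie Hcartan Hroots Hduals Hweyl Hpos Htorus Hreg gJ' Ha).
exact: (gak_diag Hlie Hcartan Hroots Hduals Hweyl Hpos Htorus Hreg HJ Ha).
Qed.
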